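(* For every integer $n\ge 1$, \[ \mu(\mathbb Z_n)=\begin{cases}\infty, & 1\le n\le 8,\\ 6, & n\ge 9.\end{cases} \] Equivalently, every admissible subset of $\mathbb Z_n$ is partitionable for $1\le n\le 8$, while for each $n\ge 9$ there is a six-element admissible subset of $\mathbb Z_n$ with no zero-sum triple partition.
   Context: $\mathbb Z_n$ denotes the (additive) cyclic group of order $n$. For a finite subset $S$ of an abelian group $G$, write $\sigma(S)=\sum_{s\in S}s\in G$. A zero-sum triple partition of $S$ is a decomposition $S=T_1\sqcup\cdots\sqcup T_m$ ($m\ge 0$) into pairwise disjoint subsets with $|T_i|=3$ and $\sigma(T_i)=0$ for every $i$ (for $m=0$ this is the empty partition of the empty set). A finite subset $S\subseteq G$ is admissible if $3\mid |S|$ and $\sigma(S)=0$; it is partitionable if it has a zero-sum triple partition, and non-partitionable otherwise. For a finite abelian group $G$, $\mu(G)$ is the least cardinality of a non-partitionable admissible subset of $G$, with $\mu(G)=\infty$ if no such subset exists. *)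

(* Defs.v *)
From mathcomp Require Import all_boot all_order all_algebra.

Set Implicit Arguments.
Unset Strict Implicit.
Unset Printing Implicit Defensive.


(* The additive cyclic group of order n, for n >= 1. MathComp's 'Z_n is not   *)
(* suitable, since 'Z_1 has two elements.                                     *)
Notation Zmod n := 'I_n.-1.+1.

Definition sigma (G : finZmodType) (S : {set G}) : G := (\sum_(s in S) s)%R.

Definition zero_sum_triple_partition (G : finZmodType)
    (P : {set {set G}}) (S : {set G}) : bool :=
  partition P S && [forall T in P, (#|T| == 3) && (sigma T == 0%R)].

Definition admissible (G : finZmodType) (S : {set G}) : bool :=
  (3 %| #|S|) && (sigma S == 0%R).

Definition partitionable (G : finZmodType) (S : {set G}) : bool :=
  [exists P : {set {set G}}, zero_sum_triple_partition P S].

Definition nonpartitionable_admissible (G : finZmodType) (S : {set G}) : bool :=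
  admissible S && ~~ partitionable S.

(* Some k stands for the finite value k, and None for infinity. *)
Definition mu (G : finZmodType) : option nat :=
  if [pick S : {set G} | nonpartitionable_admissible S] is Some S0 then
    Some #|[arg min_(S < S0 | nonpartitionable_admissible S) #|S|]|
  else None.

(* Main.v *)
Require Import Defs.
From mathcomp Require Import all_boot all_order all_fingroup all_algebra.
From mathcomp Require Import cyclic.

(** Removing a zero-sum triple from an admissible set leaves an admissible set,
    so an admissible set with fewer than nine elements is partitionable as soon
    as it is empty or contains a zero-sum triple.  In particular a
    non-partitionable one has at least six elements.  If [u] has order at least
    nine, {±u, ±2u, ±4u} contains no zero-sum triple: three distinct members of
    {±1, ±2, ±4} have a nonzero sum of absolute value at most 7.  In Z_n with
    [n <= 8], a zero-sum 6-set has a complement of at most two elements whose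
    sum is the sum of Z_n; this leaves no set for [n = 6], only Z_7 \ {0} for
    [n = 7], and the sets Z_8 \ {a, 4 - a} for [n = 8]. *)

Set Implicit Arguments.
Unset Strict Implicit.
Unset Printing Implicit Defensive.

Import GRing.Theory.

Section Sigma.

Variable G : finZmodType.
Implicit Types S T : {set G}.

Lemma sigma_set1 (x : G) : sigma [set x] = x.
Proof. exact: big_set1. Qed.

Lemma sigma_set2 (x y : G) : x != y -> sigma [set x; y] = (x + y)%R.
Proof. by move=> xy; rewrite /sigma big_setU1 ?inE ?big_set1. Qed.

Lemma sigma_setD S T : T \subset S -> (sigma (S :\: T) = sigma S - sigma T)%R.
Proof.
move=> sTS; rewrite [sigma S](big_setID T) /= (setIidPr sTS).
by rewrite addrC addrK.
Qed.

Lemma sigma_setC S : (sigma (~: S) = sigma [set: G] - sigma S)%R.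
Proof. by rewrite -setTD sigma_setD ?subsetT. Qed.

Lemma sigma_seq (s : seq G) : uniq s -> sigma [set:: s] = (\sum_(x <- s) x)%R.
Proof.
by move=> us; rewrite big_uniq //; apply: eq_bigl => x; rewrite inE.
Qed.

End Sigma.

Section ZeroSumTriples.

Variable G : finZmodType.
Implicit Types S T : {set G}.

Definition zero_sum_triple T : bool := (#|T| == 3) && (sigma T == 0%R).

Definition has_zero_sum_triple S : bool :=
  [exists T : {set G}, (T \subset S) && zero_sum_triple T].

Lemma zero_sum_triple_neq0 T : zero_sum_triple T -> T != set0.
Proof. by rewrite -card_gt0 => /andP[/eqP->]. Qed.

Lemma has_zero_sum_tripleP S :
  reflect (exists x y z : G, [/\ [&& x \in S, y \in S & z \in S],
                                 uniq [:: x; y; z] & (x + y + z = 0)%R])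
          (has_zero_sum_triple S).
Proof.
apply: (iffP existsP) => [[T /and3P[sTS cT /eqP sT]]|[x [y [z [xyzS us s0]]]]].
  have := enum_uniq T; have := eqP cT; rewrite cardE.
  have sum_enum : (\sum_(x <- enum T) x = 0)%R by rewrite big_enum.
  have : {subset enum T <= S}.
    by move=> x; rewrite mem_enum; apply: (subsetP sTS).
  case: (enum T) sum_enum => [|x [|y [|z [|]]]] // s0 sS _ us.
  exists x, y, z; split=> //; first by rewrite !sS ?inE ?eqxx ?orbT.
  by rewrite -s0 !big_cons big_nil addr0 addrA.
exists [set:: [:: x; y; z]]; apply/and3P; split.
- case/and3P: xyzS => xS yS zS.
  by apply/subsetP => t; rewrite !inE => /or3P[] /eqP->.
- by rewrite cardsE (card_uniqP us).
- by rewrite sigma_seq // !big_cons big_nil addr0 addrA s0.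
Qed.

Lemma partitionable0 : partitionable (set0 : {set G}).
Proof.
apply/existsP; exists set0; rewrite /zero_sum_triple_partition partition_set0.
by rewrite eqxx; apply/forall_inP => T; rewrite inE.
Qed.

Lemma partitionableP S :
  S != set0 ->
  reflect (exists T : {set G},
             [/\ T \subset S, zero_sum_triple T & partitionable (S :\: T)])
          (partitionable S).
Proof.
move=> S0; apply: (iffP existsP) => [[P /andP[partP /forall_inP zP]]|].
  have /set0Pn[x xS] := S0.
  have /bigcupP[T TP _] : x \in cover P by rewrite (cover_partition partP).
  exists T; split; [exact: partitionS partP TP | exact: zP |].
  apply/existsP; exists (P :\ T); rewrite /zero_sum_triple_partition.
  by rewrite partitionD1 //; apply/forall_inP => U /setD1P[_ /zP].
case=> T [sTS zT /existsP[P /andP[partP /forall_inP zP]]].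
exists (T |: P); rewrite /zero_sum_triple_partition -{1}(setID S T).
rewrite (setIidPr sTS) partitionU1 ?zero_sum_triple_neq0 //.
  by apply/forall_inP => U /setU1P[-> | /zP].
by rewrite -setI_eq0 setIDA setIC setDIl setDv setI0.
Qed.

Lemma admissible_setD S T :
    T \subset S -> zero_sum_triple T -> admissible S ->
  admissible (S :\: T).
Proof.
move=> sTS /andP[/eqP cT /eqP sT] /andP[dS /eqP sS].
by rewrite /admissible cardsDS // cT dvdn_sub // sigma_setD // sS sT subr0 eqxx.
Qed.

Lemma admissible_card_lt6_partitionable S :
  admissible S -> #|S| < 6 -> partitionable S.
Proof.
move=> /andP[d3 sS] S6; have [-> | S0] := eqVneq S set0.
  exact: partitionable0.
have c3 : #|S| == 3.
  by move: S6 d3 S0; rewrite -card_gt0; case: #|S| => [|[|[|[|[|[|]]]]]].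
apply/partitionableP => //; exists S; rewrite /zero_sum_triple c3 setDv.
by split=> //; exact: partitionable0.
Qed.

Lemma partitionable_card_lt9 S :
    S != set0 -> #|S| < 9 -> admissible S ->
  partitionable S = has_zero_sum_triple S.
Proof.
move=> S0 S9 aS; apply/partitionableP/existsP => // -[T].
  by case=> sTS zT _; exists T; rewrite sTS.
case/andP=> sTS zT; exists T; split=> //.
apply: admissible_card_lt6_partitionable; first exact: admissible_setD.
by rewrite cardsDS // ltn_subLR ?subset_leq_card //; case/andP: zT => /eqP->.
Qed.

End ZeroSumTriples.

Section Mu.

Variable G : finZmodType.
Implicit Types S : {set G}.

Lemma mu_None : (forall S, admissible S -> partitionable S) -> mu G = None.
Proof.
by move=> allP; rewrite /mu; case: pickP => // S /andP[/allP->].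
Qed.

Lemma mu_Some S :
    nonpartitionable_admissible S ->
    (forall U : {set G}, nonpartitionable_admissible U -> #|S| <= #|U|) ->
  mu G = Some #|S|.
Proof.
move=> nS minS; rewrite /mu.
case: pickP => [S0 nS0 | /(_ S)]; last by rewrite nS.
case: arg_minnP => // U nU minU; congr Some; apply/eqP.
by rewrite eqn_leq minU // minS.
Qed.

Lemma nonpartitionable_card_ge6 S : nonpartitionable_admissible S -> 6 <= #|S|.
Proof.
case/andP=> aS; rewrite leqNgt; apply: contra.
exact: admissible_card_lt6_partitionable.
Qed.

End Mu.

Section Multiples.

Variables (G : finZmodType) (u : G).

Lemma mulrz_eq0_order (z : int) : (u *~ z == 0)%R = (#[u]%g %| `|z|%N).
Proof.
rewrite order_dvdn FinRing.zmodXgE; case: z => // k.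
by rewrite NegzE mulrNz oppr_eq0.
Qed.

Lemma mulrz_neq0_lt_order (z : int) : 0 < `|z|%N < #[u]%g -> (u *~ z != 0)%R.
Proof. by case/andP=> z0 zu; rewrite mulrz_eq0_order gtnNdvd. Qed.

Variable s : seq int.

Lemma mulrz_in_inj :
    {in s &, forall x y : int, `|x - y|%N < #[u]%g} ->
  {in s &, injective (intmul u)}.
Proof.
move=> dist_lt x y xs ys /eqP; rewrite -subr_eq0 -mulrzBr; apply: contraTeq.
rewrite -subr_eq0 -absz_gt0 => xy_gt0.
by rewrite mulrz_neq0_lt_order // xy_gt0 dist_lt.
Qed.

Definition multiples : {set G} := [set:: [seq (u *~ z)%R | z <- s]].

Lemma card_multiples :
  uniq s -> {in s &, injective (intmul u)} -> #|multiples| = size s.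
Proof.
move=> us inj; rewrite cardsE -(size_map (intmul u)); apply/card_uniqP.
by rewrite map_inj_in_uniq.
Qed.

Lemma sigma_multiples :
    uniq s -> {in s &, injective (intmul u)} ->
  sigma multiples = (u *~ \sum_(z <- s) z)%R.
Proof.
by move=> us inj; rewrite sigma_seq ?map_inj_in_uniq // big_map mulrz_sumr.
Qed.

Lemma multiples_no_zero_sum_triple :
    {in s & &, forall x y z : int,
      uniq [:: x; y; z] -> (u *~ (x + y + z) != 0)%R} ->
  ~~ has_zero_sum_triple multiples.
Proof.
move=> sum_neq0; apply/has_zero_sum_tripleP => -[a [b [c []]]].
rewrite !inE => /and3P[/mapP[x xs ->] /mapP[y ys ->] /mapP[z zs ->]].
move=> /(@map_uniq _ _ _ [:: x; y; z]) uniq_xyz; rewrite -!mulrzDr => /eqP.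
exact/negP/sum_neq0.
Qed.

End Multiples.

Section PlusMinus124.

Definition pm124 : seq int := [:: 1; 2; 4; -1; -2; -4]%R.

Lemma pm124_dist_le8 : {in pm124 &, forall x y : int, `|x - y|%N <= 8}.
Proof. exact/allrelP. Qed.

Lemma pm124_triple_sum_le8 :
  {in pm124 & &, forall x y z : int,
    uniq [:: x; y; z] -> 0 < `|(x + y + z)%R|%N <= 8}.
Proof.
move=> x y z xs ys zs; apply/implyP.
have: all (fun x => all2rel (fun y z : int => uniq [:: x; y; z] ==>
  (0 < `|(x + y + z)%R|%N <= 8)) pm124) pm124 by [].
by move=> /allP/(_ x xs)/allrelP; apply.
Qed.

Variables (G : finZmodType) (u : G).
Hypothesis u_gt8 : 8 < #[u]%g.

Lemma mulrz_pm124_inj : {in pm124 &, injective (intmul u)}.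
Proof.
apply: mulrz_in_inj => x y xs ys.
exact: leq_ltn_trans (pm124_dist_le8 xs ys) u_gt8.
Qed.

Lemma card_multiples_pm124 : #|multiples u pm124| = 6.
Proof. exact: card_multiples mulrz_pm124_inj. Qed.

Lemma admissible_multiples_pm124 : admissible (multiples u pm124).
Proof.
rewrite /admissible card_multiples_pm124 sigma_multiples //=.
  by rewrite !big_cons big_nil.
exact: mulrz_pm124_inj.
Qed.

Lemma nonpartitionable_multiples_pm124 :
  nonpartitionable_admissible (multiples u pm124).
Proof.
have c6 := card_multiples_pm124; have adm := admissible_multiples_pm124.
rewrite /nonpartitionable_admissible adm /=.
rewrite partitionable_card_lt9 -?card_gt0 ?c6 //.
apply: multiples_no_zero_sum_triple => x y z xs ys zs uniq_xyz.
have /andP[sum_gt0 le8] := pm124_triple_sum_le8 xs ys zs uniq_xyz.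
by rewrite mulrz_neq0_lt_order // sum_gt0 (leq_ltn_trans le8).
Qed.

End PlusMinus124.

Lemma sigma_Zp_setT (m : nat) : sigma [set: 'I_m.+1] = inZp 'C(m.+1, 2).
Proof.
have -> : sigma [set: 'I_m.+1] = (\sum_(i < m.+1) Zp1 *+ i)%R.
  by apply: eq_big => i; rewrite ?inE // -FinRing.zmodXgE Zp1_expgz.
rewrite sumrMnr -bin2_sum big_mkord Zp_mulrn; apply: val_inj.
by rewrite /= modnMml mul1n.
Qed.

Lemma zero_sum_card6_has_triple_Z7 (S : {set 'I_7}) :
  #|S| = 6 -> sigma S = 0%R -> has_zero_sum_triple S.
Proof.
move=> cS sS; have : #|~: S| == 1 by rewrite cardsCs setCK cS card_ord.
case/cards1P=> a SC; have a0 : a = 0%R.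
  rewrite -[a]sigma_set1 -SC sigma_setC sS sigma_Zp_setT; exact/eqP.
have memS x : (x \in S) = (x != 0%R) by rewrite -[S]setCK SC a0 !inE.
apply/has_zero_sum_tripleP; exists 1%R, 2%R, 4%R.
by split; rewrite ?memS //; exact/eqP.
Qed.

(* The two missing elements are distinct and add up to [4], so the solutions [2]
   and [6] of [x + x = 4] are present, and [0] and [4] are missing together. *)
Lemma zero_sum_card6_has_triple_Z8 (S : {set 'I_8}) :
  #|S| = 6 -> sigma S = 0%R -> has_zero_sum_triple S.
Proof.
move=> cS sS; have : #|~: S| == 2 by rewrite cardsCs setCK cS card_ord.
case/cards2P=> a [b [neq_ab SC]].
have ab : (a + b = 4)%R.
  by rewrite -sigma_set2 // -SC sigma_setC sS sigma_Zp_setT; apply/eqP.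
have memS x : (x \in S) = (x \notin [set a; b]) by rewrite -SC inE negbK.
have double_mem x : (x + x = 4 -> x \in S)%R.
  rewrite memS !inE -ab => xx.
  apply: contra neq_ab => /orP[] /eqP x_eq; move: xx; rewrite x_eq.
    by move/addrI->.
  by move/addIr->.
have S2 : (2 \in S)%R by apply: double_mem; exact/eqP.
have S6 : (6 \in S)%R by apply: double_mem; exact/eqP.
apply/has_zero_sum_tripleP; have [S0 | ] := boolP (0%R \in S).
  by exists 0%R, 2%R, 6%R; split; rewrite ?S0 ?S2 ?S6 //; exact/eqP.
rewrite memS negbK => ab0; have {}SC : [set a; b] = [set 0; 4]%R.
  case/set2P: ab0 ab => <-; rewrite ?add0r ?addr0 => -> //.
  exact: setUC.
exists 1%R, 2%R, 5%R; split; rewrite ?memS ?SC ?inE //; exact/eqP.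
Qed.

Lemma zero_sum_card6_has_triple_Zp (m : nat) (S : {set 'I_m.+1}) :
  m < 8 -> #|S| = 6 -> sigma S = 0%R -> has_zero_sum_triple S.
Proof.
move=> m8 cS sS; have := max_card S; rewrite cS card_ord.
case: m m8 S cS sS => [|[|[|[|[|[|[|[|]]]]]]]] // _ S cS sS _.
- have ST : S = setT by apply/eqP; rewrite eqEcard subsetT cardsT card_ord cS.
  by move/eqP: sS; rewrite ST sigma_Zp_setT.
- exact: zero_sum_card6_has_triple_Z7.
- exact: zero_sum_card6_has_triple_Z8.
Qed.

Lemma admissible_Zp_partitionable (m : nat) (S : {set 'I_m.+1}) :
  m < 8 -> admissible S -> partitionable S.
Proof.
move=> m8 aS; have [lt6|ge6] := ltnP #|S| 6.
  exact: admissible_card_lt6_partitionable.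
have le8 : #|S| <= 8 by rewrite (leq_trans (max_card _)) ?card_ord.
rewrite partitionable_card_lt9 -?card_gt0 ?(leq_trans _ ge6) //.
have /andP[d3 /eqP sS] := aS; apply: zero_sum_card6_has_triple_Zp => //.
by move: ge6 le8 d3; case: #|S| => [|[|[|[|[|[|[|[|[|]]]]]]]]].
Qed.

Theorem corollary1p2 (n : nat) (n_ge1 : 1 <= n) :
  [/\ mu (Zmod n) = (if n <= 8 then None else Some 6),
      n <= 8 -> forall S : {set Zmod n}, admissible S -> partitionable S
    & 9 <= n -> exists S : {set Zmod n},
        [/\ #|S| = 6, admissible S
          & ~ exists P : {set {set Zmod n}}, zero_sum_triple_partition P S]].
Proof.
case: n n_ge1 => // m _ /=; have [m8 | m8] := ltnP m 8.
  have part S := @admissible_Zp_partitionable m S m8.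
  by split=> //; [exact: mu_None | rewrite ltnS leqNgt m8].
have u_gt8 : 8 < #[Zp1 : 'I_m.+1]%g by rewrite order_Zp1.
have c6 := card_multiples_pm124 u_gt8.
have nonpart := nonpartitionable_multiples_pm124 u_gt8.
split=> // [|_].
  by rewrite (mu_Some nonpart) c6 // => U /nonpartitionable_card_ge6.
have /andP[adm /negP not_part] := nonpart.
by exists (multiples Zp1 pm124); split=> // /existsP.
Qed.
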